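(* Let $\mathbf{a}:I\to\mathbb{R}^{2r}$ be a differentiable solution, on a time interval $I$, of the reduced order model (POD-ROM-I) $$\frac{d\mathbf{a}(t)}{dt}=-\mathbf{U}^T\mathcal{N}_h\big(\mathbf{U}\mathbf{a}(t)\big)\,\mathbf{U}\mathbf{U}^T\mathcal{L}_h\big[\mathbf{U}\mathbf{a}(t)\big].$$ Then, with the discrete energy $\mathcal{E}_r(\mathbf{U}\mathbf{a})=\frac12[\mathbf{U}\mathbf{a}]^T\mathcal{L}_h[\mathbf{U}\mathbf{a}]$, the energy dissipation law $$\frac{d\,\mathcal{E}_r(\mathbf{U}\mathbf{a}(t))}{dt}=-\Big(\mathbf{U}\mathbf{U}^T\mathcal{L}_h[\mathbf{U}\mathbf{a}(t)],\ \mathcal{N}_h\big(\mathbf{U}\mathbf{a}(t)\big)\mathbf{U}\mathbf{U}^T\mathcal{L}_h[\mathbf{U}\mathbf{a}(t)]\Big)\le 0$$ holds for all $t\in I$.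
   Context: Setting (spatially discretized, energy-quadratized system). Let $N\ge 1$ be the number of spatial grid points and $1\le r\le N$. The full discrete state is $\Psi=\begin{bmatrix}\phi\\ q\end{bmatrix}\in\mathbb{R}^{2N}$ with $\phi,q\in\mathbb{R}^N$. The bracket $(x,y)=x^Ty$ is the Euclidean inner product on $\mathbb{R}^{2N}$. Linear operator: $\mathcal{L}_h=\begin{bmatrix}\mathcal{L}_{0,h}&0\\0&\mathbf{I}_N\end{bmatrix}$, where $\mathcal{L}_{0,h}\in\mathbb{R}^{N\times N}$ is symmetric, positive semi-definite and invertible (hence positive definite). Mobility: $\mathcal{N}_h(\Psi)=\mathcal{N}_0(\Psi)^T(\mathcal{G}_a+\mathcal{G}_s)\mathcal{N}_0(\Psi)\in\mathbb{R}^{2N\times 2N}$, where $\mathcal{G}_a\in\mathbb{R}^{N\times N}$ is skew-symmetric, $\mathcal{G}_s\in\mathbb{R}^{N\times N}$ is symmetric positive semi-definite, and $\mathcal{N}_0(\Psi)=\begin{bmatrix}\mathbf{I}_N & \mathrm{diag}(g(\phi))\end{bmatrix}\in\mathbb{R}^{N\times 2N}$ with $g:\mathbb{R}\to\mathbb{R}$ a given function applied componentwise to $\phi$. Reduced basis: $\mathbf{U}=\begin{bmatrix}\mathbf{U}_\phi&0\\0&\mathbf{U}_q\end{bmatrix}\in\mathbb{R}^{2N\times 2r}$, where $\mathbf{U}_\phi,\mathbf{U}_q\in\mathbb{R}^{N\times r}$ have orthonormal columns (leading left singular vectors of snapshot matrices), so $\mathbf{U}^T\mathbf{U}=\mathbf{I}_{2r}$.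 The reduced unknown is $\mathbf{a}=\begin{bmatrix}\mathbf{a}_\phi\\ \mathbf{a}_q\end{bmatrix}\in\mathbb{R}^{2r}$. *)

(* Defs.v *)
From HB Require Import structures.
From mathcomp Require Import all_boot all_order all_algebra.
From mathcomp Require Import all_classical all_reals all_analysis.

Set Implicit Arguments.
Unset Strict Implicit.
Unset Printing Implicit Defensive.

Import Order.TTheory GRing.Theory Num.Theory.
Import numFieldNormedType.Exports.

Local Open Scope classical_set_scope.
Local Open Scope ring_scope.

(* [f] has derivative [df] at [t] relative to [D]: the two-sided derivative at
   interior points of an interval [D], the one-sided derivative at an endpoint
   belonging to [D]. Only the values of [f] on [D] and at [t] matter. *)
Definition has_derivative_within (R : realType) (V : normedModType R)
    (D : set R) (f : R -> V) (t : R) (df : V) : Prop :=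
  ((s - t)^-1 *: (f s - f t)) @[s --> within D t^'] --> df.

Definition inner (R : realType) (n : nat) (x y : 'cV[R]_n) : R :=
  (x^T *m y) ord0 ord0.

Definition is_symmetric (R : realType) (n : nat) (A : 'M[R]_n) : Prop :=
  A^T = A.

Definition is_skew_symmetric (R : realType) (n : nat) (A : 'M[R]_n) : Prop :=
  A^T = - A.

Definition is_positive_semidefinite (R : realType) (n : nat) (A : 'M[R]_n) :
    Prop :=
  forall x : 'cV[R]_n, 0 <= inner x (A *m x).

Definition has_orthonormal_columns (R : realType) (m n : nat)
    (A : 'M[R]_(m, n)) : Prop :=
  forall i j : 'I_n, inner (col i A) (col j A) = (i == j)%:R.

(* R^{2N} is ['cV[R]_(N + N)]: a state [Psi] has the blocks
   phi = [usubmx Psi] and q = [dsubmx Psi]. *)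

Definition Lh (R : realType) (N : nat) (L0 : 'M[R]_N) : 'M[R]_(N + N) :=
  block_mx L0 0 0 1%:M.

Definition N0 (R : realType) (N : nat) (g : R -> R) (Psi : 'cV[R]_(N + N)) :
    'M[R]_(N, N + N) :=
  row_mx 1%:M (diag_mx (map_mx g (usubmx Psi))^T).

Definition Nh (R : realType) (N : nat) (g : R -> R) (Ga Gs : 'M[R]_N)
    (Psi : 'cV[R]_(N + N)) : 'M[R]_(N + N) :=
  (N0 g Psi)^T *m (Ga + Gs) *m N0 g Psi.

Definition reduced_basis (R : realType) (N r : nat) (Uphi Uq : 'M[R]_(N, r)) :
    'M[R]_(N + N, r + r) :=
  block_mx Uphi 0 0 Uq.

Definition energy (R : realType) (N : nat) (L0 : 'M[R]_N)
    (Psi : 'cV[R]_(N + N)) : R :=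
  2^-1 * inner Psi (Lh L0 *m Psi).

Definition pod_rom_I_rhs (R : realType) (N r : nat) (g : R -> R)
    (L0 Ga Gs : 'M[R]_N) (U : 'M[R]_(N + N, r + r)) (a : 'cV[R]_(r + r)) :
    'cV[R]_(r + r) :=
  - (U^T *m Nh g Ga Gs (U *m a) *m U *m U^T *m Lh L0 *m (U *m a)).

(* Main.v *)
(** In the reduced variables the energy is the quadratic form a^T M a / 2 of the
symmetric matrix M = U^T Lh U, so its derivative is (M a, a'). Along the
reduced flow a' = - U^T Nh U (M a), and moving U^T across the inner product
turns this into -(v, Nh v) with v = U (M a). Since Nh = N0^T (Ga + Gs) N0, the
skew part Ga drops out and Gs contributes a nonnegative term. *)
Require Import Defs.
From HB Require Import structures.
From mathcomp Require Import all_boot all_order all_algebra.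
From mathcomp Require Import all_classical all_reals all_analysis.

Import Order.TTheory GRing.Theory Num.Theory.
Import numFieldNormedType.Exports.

Local Open Scope classical_set_scope.
Local Open Scope ring_scope.

Lemma innerC (R : realType) (n : nat) (x y : 'cV[R]_n) : inner x y = inner y x.
Proof. by rewrite /inner -[x^T *m y]trmxK trmx_mul trmxK mxE. Qed.

Lemma inner_mulmxl (R : realType) (m n : nat) (A : 'M[R]_(m, n))
    (x : 'cV[R]_n) (y : 'cV[R]_m) : inner (A *m x) y = inner x (A^T *m y).
Proof. by rewrite /inner trmx_mul mulmxA. Qed.

Lemma innerDl (R : realType) (n : nat) (x y z : 'cV[R]_n) :
  inner (x + y) z = inner x z + inner y z.
Proof. by rewrite /inner linearD mulmxDl mxE. Qed.

Lemma innerDr (R : realType) (n : nat) (x y z : 'cV[R]_n) :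
  inner x (y + z) = inner x y + inner x z.
Proof. by rewrite /inner mulmxDr mxE. Qed.

Lemma innerNr (R : realType) (n : nat) (x y : 'cV[R]_n) :
  inner x (- y) = - inner x y.
Proof. by rewrite /inner mulmxN mxE. Qed.

Lemma innerZr (R : realType) (n : nat) (c : R) (x y : 'cV[R]_n) :
  inner x (c *: y) = c * inner x y.
Proof. by rewrite /inner -scalemxAr mxE. Qed.

(** Symmetry of [inner] and [A^T = - A] make the value its own negative, so it vanishes in
    characteristic zero. *)
Lemma inner_skew (R : realType) (n : nat) (A : 'M[R]_n) (x : 'cV[R]_n) :
  is_skew_symmetric A -> inner x (A *m x) = 0.
Proof.
move=> hA; have : inner x (A *m x) = - inner x (A *m x).
  by rewrite {1}innerC inner_mulmxl hA mulNmx innerNr.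
by move/eqP; rewrite -subr_eq0 opprK -mulr2n mulrn_eq0 => /eqP.
Qed.

Lemma inner_Nh_ge0 (R : realType) (N : nat) (g : R -> R) (Ga Gs : 'M[R]_N)
    (Psi v : 'cV[R]_(N + N)) :
  is_skew_symmetric Ga -> is_positive_semidefinite Gs ->
  0 <= inner v (Nh g Ga Gs Psi *m v).
Proof.
(* Carrying [N0^T] to the left leaves the form of [Ga + Gs] at the vector [N0 g Psi *m v]. *)
move=> hGa hGs; rewrite /Nh -!mulmxA -inner_mulmxl mulmxDl innerDr.
by rewrite inner_skew// add0r.
Qed.

Lemma Lh_symmetric (R : realType) (N : nat) (L0 : 'M[R]_N) :
  is_symmetric L0 -> is_symmetric (Lh L0).
Proof.
by move=> hL0; rewrite /is_symmetric /Lh tr_block_mx !trmx0 trmx1 hL0.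
Qed.

(** Difference of squares for a quadratic form: symmetry cancels the cross terms. It exposes the
    increment [x - y] in difference quotients. *)
Lemma inner_symmetric_subr (R : realType) (n : nat) (A : 'M[R]_n)
    (x y : 'cV[R]_n) : is_symmetric A ->
  inner x (A *m x) - inner y (A *m y) = inner (x + y) (A *m (x - y)).
Proof.
move=> hA; have hxy : inner y (A *m x) = inner x (A *m y).
  by rewrite innerC inner_mulmxl hA.
by rewrite mulmxDr mulmxN innerDl !innerDr !innerNr hxy addrA subrK.
Qed.

Lemma cvg_coord (R : realType) (n : nat) (T : Type) (F : set_system T)
    (FF : Filter F) (f : T -> 'cV[R]_n) (l : 'cV[R]_n) (i : 'I_n) (j : 'I_1) :
  f @ F --> l -> (fun s => f s i j) @ F --> l i j.
Proof.
move=> hf; apply: (cvg_comp f (fun M : 'cV[R]_n => M i j) hf).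
exact: coord_continuous.
Qed.

Lemma cvg_inner (R : realType) (n : nat) (T : Type) (F : set_system T)
    (FF : Filter F) (A : 'M[R]_n) (f h : T -> 'cV[R]_n) (k l : 'cV[R]_n) :
  f @ F --> k -> h @ F --> l ->
  (fun s => inner (f s) (A *m h s)) @ F --> inner k (A *m l).
Proof.
move=> hf hh.
(* In coordinates the form is a finite sum of products, so limits pass through sums and products of
   scalars. *)
have innerE x y : inner x (A *m y) =
    \sum_i x i ord0 * \sum_j A i j * y j ord0.
  by rewrite /inner mxE; apply: eq_bigr => i _; rewrite !mxE.
under eq_fun do rewrite innerE.
rewrite innerE.
apply: cvg_big => [|i _]; first exact: add_continuous.
apply: cvgM; first exact: cvg_coord.
apply: cvg_big => [|j _]; first exact: add_continuous.
by apply: cvgM; [exact: cvg_cst|exact: cvg_coord].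
Qed.

(** Differentiability gives continuity: [f s] is [f t] plus [s - t] times the difference quotient,
    and that product tends to 0. *)
Lemma has_derivative_within_cvg (R : realType) (V : normedModType R)
    (D : set R) (f : R -> V) (t : R) (df : V) :
  has_derivative_within D f t df -> f s @[s --> within D t^'] --> f t.
Proof.
move=> hf.
have hs : (s - t) @[s --> within D t^'] --> (0 : R).
  rewrite -(subrr t); apply: cvgB; last exact: cvg_cst.
  apply: cvg_trans (@nbhs_dnbhs _ t); exact: cvg_within.
have : f t + (s - t) *: ((s - t)^-1 *: (f s - f t)) @[s --> within D t^']
    --> f t + (0 : R) *: df.
  by apply: cvgD; [exact: cvg_cst|exact: cvgZ].
rewrite scale0r addr0; apply: cvg_trans; apply: near_eq_cvg.
(* The rebuilt expression equals [f s] only for [s != t], which the punctured neighbourhood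
   provides. *)
apply: (@cvg_within _ (t^')); near=> s.
rewrite scalerA mulfV ?scale1r ?subrKC// subr_eq0.
near: s; exact: nbhs_dnbhs_neq.
Unshelve. all: by end_near. Qed.

(** The difference quotient of the form is half the pairing of [a s + a t] with [A] times the
    difference quotient of [a]; both factors converge. *)
Lemma has_derivative_within_quadratic (R : realType) (n : nat) (A : 'M[R]_n)
    (D : set R) (a : R -> 'cV[R]_n) (t : R) (da : 'cV[R]_n) :
  is_symmetric A -> has_derivative_within D a t da ->
  has_derivative_within D (fun s => 2^-1 * inner (a s) (A *m a s) : R^o) t
    (inner (a t) (A *m da)).
Proof.
move=> hA ha; rewrite /has_derivative_within.
(* The derivative is written as the limit of that pairing, where [a s + a t] tends to
   [a t + a t]. *)
have -> : inner (a t) (A *m da) = 2^-1 * inner (a t + a t) (A *m da).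
  by rewrite innerDl mulrC mulrDl -splitr.
under eq_fun => s.
  rewrite -mulrBr inner_symmetric_subr// -[_ *: _]/(_ * _) mulrCA -innerZr
    scalemxAr.
  over.
apply: (@cvgM R); first exact: cvg_cst.
apply: cvg_inner => //.
by apply: cvgD; [exact: has_derivative_within_cvg ha|exact: cvg_cst].
Qed.

Theorem theorem3p1 (R : realType) (N r : nat)
  (hN : (1 <= N)%N) (hr : (1 <= r)%N) (hrN : (r <= N)%N)
  (L0 : 'M[R]_N)
  (hL0sym : is_symmetric L0)
  (hL0psd : is_positive_semidefinite L0)
  (hL0inv : L0 \in unitmx)
  (Ga Gs : 'M[R]_N)
  (hGa : is_skew_symmetric Ga)
  (hGssym : is_symmetric Gs)
  (hGspsd : is_positive_semidefinite Gs)
  (g : R -> R)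
  (Uphi Uq : 'M[R]_(N, r))
  (hUphi : has_orthonormal_columns Uphi)
  (hUq : has_orthonormal_columns Uq)
  (I : set R)
  (hI : is_interval I)
  (hI_nondegenerate : exists s u : R, I s /\ I u /\ s < u)
  (a : R -> 'cV[R]_(r + r))
  (ha : forall t : R, I t ->
    has_derivative_within I a t
      (pod_rom_I_rhs g L0 Ga Gs (reduced_basis Uphi Uq) (a t))) :
  forall t : R, I t ->
    let U := reduced_basis Uphi Uq in
    let v := U *m U^T *m Lh L0 *m (U *m a t) in
    let dissipation := inner v (Nh g Ga Gs (U *m a t) *m v) in
    has_derivative_within I (fun s : R => energy L0 (U *m a s) : R^o) t
      (- dissipation)
    /\ - dissipation <= 0.
Proof.
move=> t It U v dissipation; split; last by rewrite oppr_le0 inner_Nh_ge0.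
pose M := U^T *m Lh L0 *m U.
have hM : is_symmetric M.
  by rewrite /is_symmetric /M !trmx_mul trmxK Lh_symmetric// mulmxA.
have energyE s : energy L0 (U *m a s) = 2^-1 * inner (a s) (M *m a s).
  by rewrite /energy inner_mulmxl /M !mulmxA.
under eq_fun do rewrite energyE.
have -> : - dissipation =
    inner (a t) (M *m pod_rom_I_rhs g L0 Ga Gs U (a t)).
  (* Symmetry of [M] moves it onto [a t]; the leading [U] of [v] then crosses as [U^T], matching the
     factor in the reduced flow. *)
  rewrite /pod_rom_I_rhs mulmxN innerNr -{1}hM -inner_mulmxl.
  rewrite /dissipation /v /M; congr (- _).
  by rewrite -!mulmxA inner_mulmxl.
exact: has_derivative_within_quadratic (ha t It).
Qed.
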